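(* Let $\Lambda$ be a uniformly discrete sequence of real numbers and let $g\in L^2(\mathbb{R})$ be such that the system of translates $\{g(t-\lambda)\}_{\lambda\in\Lambda}$ is a $(QF)$-system for $L^2(\mathbb{R})$. Then $g\notin L^1(\mathbb{R})$.
   Context: A set (sequence) $\Lambda$ of real numbers is uniformly discrete if $\inf_{\lambda\neq\lambda',\ \lambda,\lambda'\in\Lambda}|\lambda-\lambda'|>0$. A system of vectors $\{u_n\}$ in a Hilbert space $H$ is called a $(QF)$-system if the following two conditions hold: (i) for every $q>2$ there is a constant $C(q)$ such that, for every $f\in H$ and every $\epsilon>0$, there is a (finite) linear combination $Q=\sum c_n u_n$ with $\|f-Q\|<\epsilon$ and $\|\{c_n\}\|_{l_q}\le C(q)\|f\|$; (ii) (Bessel inequality) there is a constant $C'$, not depending on $f$, such that $\left(\sum|\langle f,u_n\rangle|^2\right)^{1/2}\le C'\|f\|$ for all $f\in H$. *)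

(* Defs.v *)
From HB Require Import structures.
From mathcomp Require Import all_boot all_order all_algebra finmap.
From mathcomp Require Import all_classical all_reals all_analysis.
From mathcomp Require Import measurable_realfun.
From mathcomp Require Import sesquilinear complex ring lra.

Set Implicit Arguments.
Unset Strict Implicit.
Unset Printing Implicit Defensive.

Import Order.TTheory GRing.Theory Num.Theory.
Import numFieldNormedType.Exports.

Local Open Scope classical_set_scope.
Local Open Scope ring_scope.
Local Open Scope complex_scope.

(* [Re] and [Im] alone denote the maps [C -> C] of a numClosedFieldType. *)
Notation ReR := (@complex.Re _).
Notation ImR := (@complex.Im _).
Notation normc := (@ComplexField.Normc.normc _).

Section complex_Lfun.
Context (d : measure_display) (T : measurableType d) (R : realType).
Variable mu : {measure set T -> \bar R}.

Definition CLfun (p : \bar R) : {pred T -> R[i]} := mem [set f : T -> R[i] |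
  [/\ measurable_fun setT (ReR \o f), measurable_fun setT (ImR \o f)
    & finite_norm mu p (normc \o f)]].

Lemma CLfunE p (f : T -> R[i]) : f \in CLfun p <->
  [/\ measurable_fun setT (ReR \o f), measurable_fun setT (ImR \o f)
    & finite_norm mu p (normc \o f)].
Proof. by split; rewrite inE. Qed.

Lemma LfunE p (f : T -> R) : f \in Lfun mu p <->
  measurable_fun setT f /\ finite_norm mu p f.
Proof.
split=> [/andP[]|[mf ff]]; rewrite ?inE//=.
by apply/andP; split; rewrite inE.
Qed.

Lemma le_finite_norm (r : R) (f g : T -> R) : 0 < r ->
  measurable_fun setT f -> measurable_fun setT g ->
  (forall x, `|f x| <= `|g x|) ->
  finite_norm mu r%:E g -> finite_norm mu r%:E f.
Proof.
move=> r0 mf mg fg; apply: le_lt_trans; rewrite unlock.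
have mp (h : T -> R) : measurable_fun setT h ->
    measurable_fun setT (fun x => (`|(EFin \o h) x| `^ r)%E).
  move=> mh; rewrite (_ : (fun _ => _) = EFin \o (fun x => `|h x| `^ r))//.
  apply/measurable_EFinP.
  apply: (@measurableT_comp _ _ _ _ _ _ (@powR R ^~ r)) => //.
  exact: measurableT_comp.
apply: gt0_ler_poweR; first by rewrite invr_ge0 ltW.
- by rewrite in_itv/= leey integral_ge0// => x _; exact: poweR_ge0.
- by rewrite in_itv/= leey integral_ge0// => x _; exact: poweR_ge0.
apply: ge0_le_integral => //.
- by move=> x _; exact: poweR_ge0.
- exact: mp.
- exact: mp.
by move=> x _ /=; rewrite lee_fin ge0_ler_powR ?nnegrE// ltW.
Qed.

Lemma normcE (z : R[i]) : normc z = Num.sqrt (ReR z ^+ 2 + ImR z ^+ 2).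
Proof. by case: z. Qed.

Lemma normc_ge0 (z : R[i]) : 0 <= normc z.
Proof. by rewrite normcE sqrtr_ge0. Qed.

Lemma Re_le_normc (z : R[i]) : `|ReR z| <= normc z.
Proof. by rewrite normcE -sqrtr_sqr ler_wsqrtr// lerDl sqr_ge0. Qed.

Lemma Im_le_normc (z : R[i]) : `|ImR z| <= normc z.
Proof. by rewrite normcE -sqrtr_sqr ler_wsqrtr// lerDr sqr_ge0. Qed.

Lemma normc_le (z : R[i]) : normc z <= `|ReR z| + `|ImR z|.
Proof.
rewrite normcE -[leRHS]ger0_norm ?addr_ge0// -sqrtr_sqr ler_wsqrtr//.
rewrite -[ReR z ^+ 2]real_normK ?num_real// -[ImR z ^+ 2]real_normK ?num_real//.
by rewrite sqrrD addrAC lerDl mulrn_wge0// mulr_ge0.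
Qed.

Lemma measurable_normc (f : T -> R[i]) :
  measurable_fun setT (ReR \o f) -> measurable_fun setT (ImR \o f) ->
  measurable_fun setT (normc \o f).
Proof.
move=> mr mi.
rewrite (_ : _ \o _ =
    Num.sqrt \o (fun x => (ReR \o f) x ^+ 2 + (ImR \o f) x ^+ 2)); last first.
  by apply/funext => x /=; rewrite normcE.
apply: measurableT_comp.
  by apply: continuous_measurable_fun; exact: sqrt_continuous.
by apply: measurable_funD; exact: measurable_funX.
Qed.

Lemma CLfunP (r : R) (f : T -> R[i]) : 1 <= r ->
  f \in CLfun r%:E <->
  ReR \o f \in Lfun mu r%:E /\ ImR \o f \in Lfun mu r%:E.
Proof.
move=> r1; have r0 : 0 < r by apply: lt_le_trans r1.
split=> [/CLfunE[mr mi ff]|[/LfunE[mr fr] /LfunE[mi fi]]].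
  have mn := measurable_normc mr mi.
  by split; apply/LfunE; split=> //; apply: (le_finite_norm r0 _ mn _ ff) => // x;
    rewrite [leRHS]ger0_norm ?normc_ge0//=; [exact: Re_le_normc|exact: Im_le_normc].
apply/CLfunE; split=> //; have mn := measurable_normc mr mi.
have mar : measurable_fun setT (@Num.Def.normr R R \o (ReR \o f)) by exact: measurableT_comp.
have mai : measurable_fun setT (@Num.Def.normr R R \o (ImR \o f)) by exact: measurableT_comp.
have /LfunE[ms fs] :
    ((Num.Def.normr \o (ReR \o f)) \+ (Num.Def.normr \o (ImR \o f)) : T -> R) \in Lfun mu r%:E.
  apply/LfunE; split; first exact: measurable_funD.
  have r1' : (1 <= r%:E)%E by rewrite lee_fin.
  apply: le_lt_trans (eminkowski mu mar mai r1') _; apply: lte_add_pinfty.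
    by apply: (le_finite_norm r0 mar mr _ fr) => x /=; rewrite normr_id.
  by apply: (le_finite_norm r0 mai mi _ fi) => x /=; rewrite normr_id.
apply: (le_finite_norm r0 mn ms _ fs) => x /=.
by rewrite [leRHS]ger0_norm ?addr_ge0// ger0_norm ?normc_ge0// normc_le.
Qed.

Let le12 : (1 <= 2 :> R). Proof. by rewrite ler1n. Qed.

Lemma Lfun_lincomb (r a b : R) (f g : T -> R) : 1 <= r ->
  f \in Lfun mu r%:E -> g \in Lfun mu r%:E ->
  (fun x => a * f x + b * g x) \in Lfun mu r%:E.
Proof.
move=> r1 hf hg; have r1' : (1 <= r%:E)%E by rewrite lee_fin.
have [h0 h] := Lfun_submod_closed mu r1'.
have -> : (fun x => a * f x + b * g x) = a *: f + (b *: g + 0).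
  by rewrite addr0; apply/funext.
by apply: (h) => //; exact: (h).
Qed.

Lemma CLfun2_submod_closed : submod_closed (CLfun 2%:E).
Proof.
split=> [|a f g /(CLfunP _ le12)[fr fi] /(CLfunP _ le12)[gr gi]].
  apply/(CLfunP _ le12).
  have e12 : (1 <= 2%:E :> \bar R)%E by rewrite lee_fin.
  by have [h0 _] := Lfun_submod_closed mu e12; split; exact: h0.
apply/(CLfunP _ le12); split.
- have h1 := Lfun_lincomb (ReR a) (- ImR a) le12 fr fi.
  apply: etrans (Lfun_lincomb 1 1 le12 h1 gr).
  apply: (congr1 (fun F : T -> R => F \in Lfun mu 2%:E)).
  apply/funext => x /=.
  have -> : (a *: f + g) x = a * f x + g x by [].
  by case: (a) (f x) (g x) => [? ?] [? ?] [? ?] /=; ring.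
- have h1 := Lfun_lincomb (ReR a) (ImR a) le12 fi fr.
  apply: etrans (Lfun_lincomb 1 1 le12 h1 gi).
  apply: (congr1 (fun F : T -> R => F \in Lfun mu 2%:E)).
  apply/funext => x /=.
  have -> : (a *: f + g) x = a * f x + g x by [].
  by case: (a) (f x) (g x) => [? ?] [? ?] [? ?] /=; ring.
Qed.

HB.instance Definition _ :=
  GRing.isSubmodClosed.Build R[i] (T -> R[i]) (CLfun 2%:E) CLfun2_submod_closed.

(* As with [LfunType], functions that agree almost everywhere are not
   identified: the inner product below is only positive semidefinite, and it
   and its seminorm do not depend on the chosen representatives. *)
Record CL2 := MkCL2 { CL2_fun :> T -> R[i] ; CL2P : CL2_fun \in CLfun 2%:E }.

HB.instance Definition _ := [isSub for CL2_fun].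
HB.instance Definition _ := [Choice of CL2 by <:].
HB.instance Definition _ := [SubChoice_isSubLmodule of CL2 by <:].

(* The inner product is [\int f \bar{g}], linear in its first argument; the
   integral of a complex function is taken on real and imaginary parts. *)
Definition CL2dot (f g : CL2) : R[i] :=
  (\int[mu]_x ReR (f x * (g x)^*)) +i* (\int[mu]_x ImR (f x * (g x)^*)).

Let integrable_congr (f g : T -> \bar R) :
  f = g -> mu.-integrable setT f -> mu.-integrable setT g.
Proof. by move=> ->. Qed.

Lemma CL2_Re_mul (f g : CL2) :
  mu.-integrable setT (EFin \o (fun x => ReR (f x * (g x)^*))).
Proof.
have /(CLfunP _ le12)[fr fi] := CL2P f; have /(CLfunP _ le12)[gr gi] := CL2P g.
have := Lfun_lincomb 1 1 (lexx 1) (Lfun2_mul_Lfun1 fr gr) (Lfun2_mul_Lfun1 fi gi).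
move/Lfun1_integrable; apply: integrable_congr; apply/funext => x /=.
by congr EFin; case: (f x) (g x) => [? ?] [? ?] /=; ring.
Qed.

Lemma CL2_Im_mul (f g : CL2) :
  mu.-integrable setT (EFin \o (fun x => ImR (f x * (g x)^*))).
Proof.
have /(CLfunP _ le12)[fr fi] := CL2P f; have /(CLfunP _ le12)[gr gi] := CL2P g.
have := Lfun_lincomb 1 (-1) (lexx 1) (Lfun2_mul_Lfun1 fi gr) (Lfun2_mul_Lfun1 fr gi).
move/Lfun1_integrable; apply: integrable_congr; apply/funext => x /=.
by congr EFin; case: (f x) (g x) => [? ?] [? ?] /=; ring.
Qed.

Lemma integrable_lincomb (a b : R) (f g : T -> R) :
  mu.-integrable setT (EFin \o f) -> mu.-integrable setT (EFin \o g) ->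
  mu.-integrable setT (EFin \o (fun x => a * f x + b * g x)).
Proof.
by move=> /Lfun1_integrable hf /Lfun1_integrable hg; apply/Lfun1_integrable;
  exact: Lfun_lincomb.
Qed.

Lemma Rintegral_lincomb (a b : R) (f g : T -> R) :
  mu.-integrable setT (EFin \o f) -> mu.-integrable setT (EFin \o g) ->
  \int[mu]_x (a * f x + b * g x) = a * (\int[mu]_x f x) + b * (\int[mu]_x g x).
Proof.
have scale c (h : T -> R) : mu.-integrable setT (EFin \o h) ->
    mu.-integrable setT (EFin \o (fun x => c * h x)).
  move=> hi; have := integrable_lincomb c 0 hi hi.
  by apply: integrable_congr; apply/funext => x /=; rewrite mul0r addr0.
by move=> fi gi; rewrite RintegralD ?RintegralZl//; exact: scale.
Qed.

Lemma CL2dotC (f g : CL2) : CL2dot f g = (CL2dot g f)^*.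
Proof.
rewrite /CL2dot /=; congr (_ +i* _).
  by apply: eq_Rintegral => x _; case: (f x) (g x) => [? ?] [? ?] /=; ring.
have := Rintegral_lincomb (-1) 0 (CL2_Im_mul g f) (CL2_Im_mul g f).
rewrite mulN1r mul0r addr0 => <-.
by apply: eq_Rintegral => x _; case: (f x) (g x) => [? ?] [? ?] /=; ring.
Qed.

Lemma CL2dotl (h : CL2) : linear_for *%R (CL2dot ^~ h).
Proof.
move=> a f g; rewrite /CL2dot.
have fr := CL2_Re_mul f h; have fi := CL2_Im_mul f h.
have gr := CL2_Re_mul g h; have gi := CL2_Im_mul g h.
have re : \int[mu]_x ReR ((a *: f + g) x * (h x)^*) =
    1 * (ReR a * (\int[mu]_x ReR (f x * (h x)^*)) +
      (- ImR a) * (\int[mu]_x ImR (f x * (h x)^*)))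
    + 1 * \int[mu]_x ReR (g x * (h x)^*).
  rewrite -Rintegral_lincomb// -Rintegral_lincomb//; last exact: integrable_lincomb.
  apply: eq_Rintegral => x _.
  have -> : (a *: f + g) x = a * f x + g x by [].
  by case: (a) (f x) (g x) (h x) => [? ?] [? ?] [? ?] [? ?] /=; ring.
have im : \int[mu]_x ImR ((a *: f + g) x * (h x)^*) =
    1 * (ReR a * (\int[mu]_x ImR (f x * (h x)^*)) +
      ImR a * (\int[mu]_x ReR (f x * (h x)^*)))
    + 1 * \int[mu]_x ImR (g x * (h x)^*).
  rewrite -Rintegral_lincomb// -Rintegral_lincomb//; last exact: integrable_lincomb.
  apply: eq_Rintegral => x _.
  have -> : (a *: f + g) x = a * f x + g x by [].
  by case: (a) (f x) (g x) (h x) => [? ?] [? ?] [? ?] [? ?] /=; ring.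
rewrite re im; case: (a) => [? ?] /=.
by congr (_ +i* _); ring.
Qed.

Lemma CL2dot_bilinear :
  bilinear_for *%R (@Num.conj R[i] \; *%R) CL2dot.
Proof.
split=> [h|h a f g]; first exact: CL2dotl.
rewrite CL2dotC (CL2dotl h) rmorphD rmorphM.
by congr (_ * _ + _); rewrite [RHS]CL2dotC.
Qed.

HB.instance Definition _ := bilinear_isBilinear.Build R[i] CL2 CL2 R[i]
  *%R (@Num.conj R[i] \; *%R) CL2dot CL2dot_bilinear.

Lemma CL2dot_hermitian (f g : CL2) :
  CL2dot f g = (-1) ^+ false * Num.conj (CL2dot g f).
Proof. by rewrite expr0 mul1r CL2dotC. Qed.

HB.instance Definition _ := isHermitianSesquilinear.Build R[i] CL2 false
  (@Num.conj R[i]) CL2dot CL2dot_hermitian.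

End complex_Lfun.

Section translate.
Context (R : realType).
Local Notation mu := (@lebesgue_measure R).

Let sub_measurable (l : R) :
  measurable_fun setT ((fun t => t - l) : R -> measurableTypeR R).
Proof. exact: measurable_funB. Qed.

Lemma lebesgue_measure_translate (l : R) (A : set R) : measurable A ->
  pushforward mu ((fun t => t - l) : R -> measurableTypeR R) A = mu A.
Proof.
move=> mA; apply/esym/lebesgue_measure_unique => //=; first exact: sub_measurable.
move=> _ _ [[a b]] _ <-; rewrite /pushforward.
have -> : (fun t : R => t - l) @^-1` `]a, b] = `]a + l, b + l]%classic.
  by apply/seteqP; split=> t /=; rewrite !in_itv/= ltrBrDr lerBlDr.
rewrite !lebesgue_measure_itv/= !lte_fin ltrD2r.
by case: ifPn => // _; rewrite -!EFinB; congr EFin; ring.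
Qed.

Lemma ge0_integral_translate (l : R) (f : R -> \bar R) :
  measurable_fun setT f -> (forall x, 0 <= f x)%E ->
  (\int[mu]_x f (x - l)%R = \int[mu]_x f x)%E.
Proof.
move=> mf f0.
have /= <- := ge0_integral_pushforward (X := measurableTypeR R)
  (sub_measurable l) mu measurableT mf (fun x _ => f0 x).
apply: eq_measure_integral; first exact: sub_measurable.
by move=> ? A mA _; exact: lebesgue_measure_translate.
Qed.

Lemma CLfun_translate (l r : R) (f : R -> R[i]) :
  f \in CLfun mu r%:E -> (fun t => f (t - l)) \in CLfun mu r%:E.
Proof.
move=> /CLfunE[mr mi]; rewrite /finite_norm unlock => ff.
apply/CLfunE; split.
- exact: (measurableT_comp mr (sub_measurable l)).
- exact: (measurableT_comp mi (sub_measurable l)).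
rewrite /finite_norm unlock.
rewrite (ge0_integral_translate l
  (f := fun x => (`|(EFin \o (normc \o f)) x| `^ r)%E))//.
rewrite (_ : (fun _ => _) = EFin \o (fun x => `|(normc \o f) x| `^ r))//.
apply/measurable_EFinP.
apply: (@measurableT_comp _ _ _ _ _ _ (@powR R ^~ r)) => //.
by apply: measurableT_comp => //; exact: measurable_normc.
by move=> x; exact: poweR_ge0.
Qed.

Definition translate (l : R) (g : CL2 mu) : CL2 mu :=
  MkCL2 (CLfun_translate l (CL2P g)).

Lemma translateE (l : R) (g : CL2 mu) :
  translate l g = (fun t : R => g (t - l)) :> (R -> R[i]).
Proof. by []. Qed.

End translate.

Section QF.
Context (R : realType) (H : lmodType R[i]).
Variable dot : {hermitian H for false & @Num.conj R[i]}.

(* [dot] may be degenerate on [H]; every notion below depends on [H] only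
   through inner products and norms, hence is unchanged by passing to the
   quotient of [H] by the vectors of norm zero. *)
Definition dot_norm (f : H) : R := Num.sqrt (ReR (dot f f)).

Definition lq_norm (I : choiceType) (q : R) (F : {fset I}) (c : I -> R[i]) : R :=
  (\sum_(n <- F) normc (c n) `^ q) `^ q^-1.

Definition QF_approximation (I : choiceType) (u : I -> H) : Prop :=
  forall q : R, 2 < q -> exists C : R, forall (f : H) (e : R), 0 < e ->
    exists (F : {fset I}) (c : I -> R[i]),
      dot_norm (f - \sum_(n <- F) c n *: u n) < e /\
      lq_norm q F c <= C * dot_norm f.

Definition Bessel_inequality (I : choiceType) (u : I -> H) : Prop :=
  exists C : R, forall f : H,
    ((\esum_(n in [set: I]) (normc (dot f (u n)) ^+ 2)%:E) `^ 2^-1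
       <= (C * dot_norm f)%:E)%E.

Definition QF_system (I : choiceType) (u : I -> H) : Prop :=
  QF_approximation u /\ Bessel_inequality u.

End QF.

Lemma CL2_normE (d : measure_display) (T : measurableType d) (R : realType)
    (mu : {measure set T -> \bar R}) (f : CL2 mu) :
  ((dot_norm (@CL2dot d T R mu) f)%:E = 'N[mu]_2%:E[EFin \o (normc \o f)])%E.
Proof.
have e x : ReR (f x * (f x)^*) = normc (f x) ^+ 2.
  rewrite normcE sqr_sqrtr ?addr_ge0 ?sqr_ge0//.
  by case: (f x) => [? ?] /=; ring.
have fi := CL2_Re_mul f f.
rewrite /dot_norm /= /Rintegral unlock.
have -> : (\int[mu]_x (`|(EFin \o (normc \o f)) x| `^ 2) =
    \int[mu]_x (EFin \o (fun x => ReR (f x * (f x)^*)%R)) x)%E.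
  apply: eq_integral => x _ /=; rewrite e ger0_norm ?normc_ge0//.
  by rewrite powR_mulrn ?normc_ge0.
rewrite poweR12_sqrt.
  by rewrite -[in RHS](fineK (integrable_fin_num _ fi)).
by apply: integral_ge0 => x _; rewrite lee_fin e sqr_ge0.
Qed.

(* Distances are compared in the extended reals, where the infimum of the
   empty set is [+oo]: a set with at most one point is uniformly discrete. *)
Definition uniformly_discrete (R : realType) (L : set R) : Prop :=
  (0 < ereal_inf [set `|x.1 - x.2|%:E | x in
         [set x : R * R | [/\ L x.1, L x.2 & x.1 <> x.2]]])%E.

(* Main.v *)
(* If g is integrable, the translates of g see an oscillating window only weakly.
   Let h_n(t) = sin((n+1) pi t / d) on [0, d], zero elsewhere, with d smaller than
   the gaps of L. The h_n are orthogonal, of constant norm and bounded by 1, so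
   <h_n, u> -> 0 for every u (Bessel), while |<h_n, g(. - l)>| is at most twice
   the integral of |g| over [-l, d - l]. These intervals are disjoint, so
   sum_l |<h_n, g(. - l)>| is dominated by a convergent series uniformly in n, and
   hence tends to 0. On the other hand condition (i) for the single exponent
   q = 3 gives ||h|| <= C sum_l |<h, g(. - l)>|: expand ||h - Q||^2 and bound
   each coefficient of Q by the l_q norm. *)
Require Import Defs.
From mathcomp Require Import all_boot all_order all_algebra finmap.
From mathcomp Require Import all_classical all_reals all_analysis.
From mathcomp Require Import sesquilinear complex.
From mathcomp Require Import measurable_realfun zify ring lra.

Set Implicit Arguments.
Unset Strict Implicit.
Unset Printing Implicit Defensive.

Import Order.TTheory GRing.Theory Num.Theory.
Import numFieldNormedType.Exports.

Local Open Scope classical_set_scope.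
Local Open Scope ring_scope.

(** * Real parts and moduli of complex products *)

Section complex_modulus.
Context {R : realType}.
Implicit Types z w : R[i].

Lemma Re_mul_le_normc z w : ReR (z * w) <= normc z * normc w.
Proof.
rewrite -ComplexField.Normc.normcM.
exact: le_trans (ler_norm _) (Re_le_normc _).
Qed.

Lemma normc_conj z : normc (Num.conj z) = normc z.
Proof. by case: z => a b /=; rewrite sqrrN. Qed.

Lemma Re_conj z : ReR (Num.conj z) = ReR z.
Proof. by case: z. Qed.

Lemma Re_mul_conj z : ReR (z * Num.conj z) = normc z ^+ 2.
Proof.
rewrite Defs.normcE sqr_sqrtr ?addr_ge0 ?sqr_ge0//.
by case: z => a b /=; ring.
Qed.

End complex_modulus.

Lemma big_fset_subset (I : choiceType) (V : nmodType) (f : I -> V)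
    (A B : {fset I}) : (A `<=` B)%fset ->
  \sum_(i <- B) f i = \sum_(i <- A) f i + \sum_(i <- B | i \notin A) f i.
Proof.
move=> AB; rewrite (bigID (mem A)); congr (_ + _).
rewrite big_fset_condE; apply: eq_fbigl => i; rewrite !inE /= andbC.
by case: (boolP (i \in A)) => //= /(fsubsetP AB).
Qed.

(** * Positive semidefinite hermitian forms *)

Section semidefinite_form.
Context (R : realType) (H : lmodType R[i]).
Variable dot : {hermitian H for false & @Num.conj R[i]}.
Hypothesis dot_ge0 : forall f, 0 <= ReR (dot f f).

Lemma dotC (f g : H) : dot f g = Num.conj (dot g f).
Proof. by rewrite hermC expr0 mul1r. Qed.

Lemma normc_dotC (f g : H) : normc (dot f g) = normc (dot g f).
Proof. by rewrite dotC normc_conj. Qed.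

Lemma dot_norm_ge0 (f : H) : 0 <= dot_norm dot f.
Proof. exact: sqrtr_ge0. Qed.

Lemma dot_norm_sqr (f : H) : dot_norm dot f ^+ 2 = ReR (dot f f).
Proof. by rewrite sqr_sqrtr. Qed.

Lemma dot_normB_sqr (f g : H) : dot_norm dot (f - g) ^+ 2 =
  dot_norm dot f ^+ 2 - 2 * ReR (dot f g) + dot_norm dot g ^+ 2.
Proof.
rewrite !dot_norm_sqr linearBl !linearBr /=.
rewrite !raddfB /= (dotC g f) Re_conj; ring.
Qed.

Lemma dot_sumr_le (I : Type) (s : seq I) (c : I -> R[i]) (u : I -> H) (f : H) :
  ReR (dot f (\sum_(i <- s) c i *: u i)) <=
  \sum_(i <- s) normc (c i) * normc (dot f (u i)).
Proof.
rewrite linear_sumr raddf_sum; apply: ler_sum => i _.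
rewrite linearZr_LR /=.
by rewrite (le_trans (Re_mul_le_normc _ _))// normc_conj.
Qed.

(** * Orthogonal sequences of constant norm *)

Section bessel.
Context (h : nat -> H) (a : R).
Hypothesis a_gt0 : 0 < a.
Hypothesis dot_h : forall m n, dot (h m) (h n) = (if m == n then a else 0)%:C%C.

(** Expanding the nonnegative square of the norm of [a f - s] gives [a^2 |f|^2 - 2 a S + a S >= 0];
    dividing by [a] concludes. Scaling [f] by [a] saves normalizing the [h n]. *)
Lemma bessel_orthogonal (f : H) (N : nat) :
  \sum_(n < N) normc (dot f (h n)) ^+ 2 <= a * dot_norm dot f ^+ 2.
Proof.
pose s := \sum_(n < N) dot f (h n) *: h n.
set S := (X in X <= _).
have fs : ReR (dot (a%:C%C *: f) s) = a * S.
  rewrite linearZl_LR linear_sumr /= mulr_sumr raddf_sum mulr_sumr.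
  apply: eq_bigr => n _; rewrite linearZr_LR /=.
  rewrite -Re_mul_conj; case: (dot f (h n)) => x y /=; ring.
have ss : ReR (dot s s) = a * S.
  rewrite {1}/s linear_sumlz raddf_sum mulr_sumr; apply: eq_bigr => n _.
  rewrite linearZl_LR /= linear_sumr (bigD1 n)//= big1 ?addr0 => [|m mn].
    rewrite linearZr_LR /= dot_h eqxx -Re_mul_conj.
    by case: (dot f (h n)) => x y /=; ring.
  rewrite linearZr_LR /= dot_h eq_sym.
  by rewrite (_ : (m == n :> nat) = false) ?mulr0//; apply/negbTE.
have af : dot_norm dot (a%:C%C *: f) ^+ 2 = a ^+ 2 * dot_norm dot f ^+ 2.
  rewrite !dot_norm_sqr linearZl_LR linearZr_LR /=.
  by case: (dot f f) => x y /=; ring.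
have := sqr_ge0 (dot_norm dot (a%:C%C *: f - s)).
rewrite dot_normB_sqr fs af (dot_norm_sqr s) ss => k.
by rewrite -(ler_pM2l a_gt0); lra.
Qed.

(** Bessel bounds the partial sums of the squared moduli, so these tend to 0; the square root is
    continuous at 0. *)
Lemma orthogonal_dot_cvg0 (f : H) : normc (dot (h n) f) @[n --> \oo] --> 0.
Proof.
pose x n := normc (dot (h n) f) ^+ 2.
have sx : cvgn (series x).
  apply: nondecreasing_is_cvgn.
    by apply/nondecreasing_seqP => n; rewrite /series/= big_nat_recr//= lerDl sqr_ge0.
  exists (a * dot_norm dot f ^+ 2) => _ [N _ <-].
  rewrite /series /= big_mkord (le_trans _ (bessel_orthogonal f N))//.
  by apply: ler_sum => n _; rewrite /x normc_dotC.
have := cvg_comp _ _ (cvg_series_cvg_0 sx) (@sqrt_continuous R 0).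
rewrite sqrtr0; apply: cvg_trans.
apply: near_eq_cvg; near=> n => /=.
by rewrite sqrtr_sqr ger0_norm ?normc_ge0.
Unshelve. all: by end_near. Qed.

End bessel.

(** * Consequences of the approximation condition *)

Lemma normc_le_lq_norm (I : choiceType) (q : R) (F : {fset I}) (c : I -> R[i]) i :
  0 < q -> i \in F -> normc (c i) <= lq_norm q F c.
Proof.
move=> q0 iF; rewrite /lq_norm.
have {1}-> : normc (c i) = (normc (c i) `^ q) `^ q^-1.
  by rewrite -powRrM divff ?gt_eqF// powRr1 ?normc_ge0.
apply: ge0_ler_powR; rewrite ?nnegrE ?invr_ge0 ?(ltW q0) ?powR_ge0//.
  by apply: sumr_ge0 => j _; exact: powR_ge0.
rewrite (big_fsetD1 i)//= lerDl.
by apply: sumr_ge0 => j _; exact: powR_ge0.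
Qed.

(** For [Q] within [|f| / 2] of [f], expanding [|f - Q|^2] gives [3/4 |f|^2 <= 2 Re <f, Q>], and
    [Re <f, Q>] is at most a bound on the coefficients times the sum of the [|<f, u n>|]. *)
Lemma QF_approximation_lower_bound (I : choiceType) (u : I -> H) :
  QF_approximation dot u -> exists2 C : R, 0 <= C & forall f,
    0 < dot_norm dot f -> exists F : {fset I},
    dot_norm dot f <= C * \sum_(n <- F) normc (dot f (u n)).
Proof.
(* The maximum is there because nothing fixes the sign of [C]; the factor 4 leaves room above the
   8/3 that the expansion yields. *)
move=> /(_ 3 ltac:(lra))[C QC]; exists (4 * Num.max C 0).
  by rewrite mulr_ge0// le_max lexx orbT.
move=> f f0; have [F [c [fQ cC]]] := QC f (dot_norm dot f / 2) ltac:(lra).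
exists F; set S := \sum_(n <- F) _; set Q := \sum_(n <- F) _ in fQ.
set N := dot_norm dot f in f0 fQ cC *.
have S0 : 0 <= S by apply: sumr_ge0 => n _; exact: normc_ge0.
have {}cC : lq_norm 3 F c <= Num.max C 0 * N.
  by rewrite (le_trans cC)// ler_pM2r// le_max lexx.
have QS : ReR (dot f Q) <= Num.max C 0 * N * S.
  rewrite (le_trans (dot_sumr_le _ _ _ _))// mulr_sumr.
  rewrite big_seq [leRHS]big_seq; apply: ler_sum => n nF.
  rewrite ler_wpM2r ?normc_ge0// (le_trans _ cC)//.
  by apply: normc_le_lq_norm => //; lra.
have : dot_norm dot (f - Q) ^+ 2 <= (N / 2) ^+ 2.
  by rewrite lerXn2r ?nnegrE ?dot_norm_ge0 ?divr_ge0// ltW.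
rewrite dot_normB_sqr -/N => k.
have := sqr_ge0 (dot_norm dot Q) => Q0.
rewrite -(ler_pM2l f0) -/N; nra.
Qed.

(** The bound [b] with bounded finite sums lets the limit in [n] be taken inside the sum over [i],
    as in dominated convergence. The sums of [|<h n, u i>|] then become small uniformly in [F],
    against the lower bound for the fixed norm [sqrt a]. *)
Lemma not_QF_approximation (I : choiceType) (u : I -> H) (h : nat -> H)
    (a M : R) (b : I -> R) :
  0 < a -> (forall m n, dot (h m) (h n) = (if m == n then a else 0)%:C%C) ->
  (forall n i, normc (dot (h n) (u i)) <= b i) ->
  (forall F : {fset I}, \sum_(i <- F) b i <= M) ->
  ~ QF_approximation dot u.
Proof.
move=> a0 hh hb bM /QF_approximation_lower_bound[C C0 lower].
have b0 i : 0 <= b i by apply: le_trans (hb 0%N i); exact: normc_ge0.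
have nh n : dot_norm dot (h n) = Num.sqrt a by rewrite /dot_norm hh eqxx.
have r0 : 0 < Num.sqrt a by rewrite sqrtr_gt0.
(* Chosen so that [C * (2 * e) < 4 * (C + 1) * e = sqrt a]. *)
pose e := Num.sqrt a / (4 * (C + 1)).
have e0 : 0 < e by rewrite divr_gt0// mulr_gt0//; lra.
(* Outside a finite [F0] almost realizing the supremum of the sums of [b],
   the terms are small uniformly in [n]. *)
pose B := [set \sum_(i <- F) b i | F in [set: {fset I}]].
have hB : has_sup B.
  split; first by exists (\sum_(i <- fset0) b i), fset0.
  by exists M => _ [F _ <-].
have [_ [F0 _ <-] F0e] := sup_adherent e0 hB.
(* On the finite set [F0] the limit is taken termwise, which fixes an [n] before [F] is known. *)
have : (\sum_(i <- F0) normc (dot (h n) (u i))) @[n --> \oo] --> \sum_(i <- F0) (0 : R).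
  apply: cvg_big => [|i _]; first exact: add_continuous.
  exact: orthogonal_dot_cvg0 a0 hh _.
rewrite big1_eq => /cvgr_lt /(_ e e0) [n _ /(_ n (leqnn n))] /= small.
have [F] := lower (h n) ltac:(by rewrite nh).
rewrite nh; apply/negP; rewrite -ltNge.
(* Enlarge [F] to its union with [F0]: the part in [F0] is below [e] by the choice of [n], the rest
   by the choice of [F0]. *)
have tail : \sum_(i <- F) normc (dot (h n) (u i)) < 2 * e.
  have FG : (F `<=` F `|` F0)%fset := fsubsetUl F F0.
  have F0G : (F0 `<=` F `|` F0)%fset := fsubsetUr F F0.
  have le : \sum_(i <- (F `|` F0)%fset | i \notin F0) normc (dot (h n) (u i)) <=
      \sum_(i <- (F `|` F0)%fset | i \notin F0) b i by apply: ler_sum => i _.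
  have F_ge0 : 0 <= \sum_(i <- (F `|` F0)%fset | i \notin F) normc (dot (h n) (u i)).
    by apply: sumr_ge0 => i _; exact: normc_ge0.
  have := sup_upper_bound hB (ex_intro2 _ _ (F `|` F0)%fset Logic.I erefl).
  rewrite (big_fset_subset _ F0G).
  have := big_fset_subset (fun i => normc (dot (h n) (u i))) F0G.
  rewrite (big_fset_subset _ FG); lra.
have C1 : 0 < C + 1 by lra.
apply: le_lt_trans (_ : C * (2 * e) < _); first by rewrite ler_wpM2l// ltW.
have -> : Num.sqrt a = (C + 1) * (4 * e) by rewrite /e; field; lra.
nra.
Qed.

End semidefinite_form.

(** * Orthogonality of the sines on [[0, d]] *)

Section sine_system.
Context {R : realType}.
Local Notation mu := (@lebesgue_measure R).
Implicit Types (f F : R -> R) (a b d p q : R).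

Lemma Rintegral_FTC F f a b : a < b -> continuous f ->
  (forall x : R, is_derive x 1 F (f x)) ->
  \int[mu]_(x in `[a, b]) f x = F b - F a.
Proof.
move=> ab cf dF; have cF : continuous F.
  move=> x; apply: differentiable_continuous.
  by apply/derivable1_diffP; exact: (@ex_derive _ _ _ _ _ _ _ (dF x)).
rewrite /Rintegral (@continuous_FTC2 _ _ F)//.
- exact: continuous_subspaceT.
- split=> [x _||]; first exact: (@ex_derive _ _ _ _ _ _ _ (dF x)).
  + exact/cvg_at_right_filter/cF.
  + exact/cvg_at_left_filter/cF.
- by move=> x _; rewrite derive1E; exact: derive_val.
Qed.

Lemma sin_natpi n : sin (n%:R * pi) = 0 :> R.
Proof.
elim: n => [|n IH]; first by rewrite mul0r sin0.
by rewrite -addn1 natrD mulrDl mul1r sinDpi IH oppr0.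
Qed.

Lemma continuous_sinM p : continuous (fun t => sin (p * t)).
Proof.
move=> x; apply: continuous_comp; last exact: continuous_sin.
exact: mulrl_continuous.
Qed.

Lemma is_derive_sinM p (x : R) :
  is_derive x 1 (fun t : R => sin (p * t)) (p * cos (p * x)).
Proof.
have dp : is_derive x 1 (fun t : R => p * t) p.
  have := is_deriveZ p (is_derive_id x (1 : R)).
  by rewrite /GRing.scale/= mulr1.
have := is_derive1_comp (is_derive_sin (p * x)) dp.
by rewrite /GRing.scale/= mulrC.
Qed.

Lemma Rintegral_sin_mul p q d : 0 < d -> p != q -> p + q != 0 ->
  sin ((p - q) * d) = 0 -> sin ((p + q) * d) = 0 ->
  \int[mu]_(t in `[0, d]) (sin (p * t) * sin (q * t)) = 0.
Proof.
move=> d0 pq pq' sB sD.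
have {}pq : p - q != 0 by rewrite subr_eq0.
(* Antiderivative from [sin(pt) sin(qt) = (cos((p-q)t) - cos((p+q)t)) / 2]. *)
pose F (t : R) :=
  (2 * (p - q))^-1 * sin ((p - q) * t) - (2 * (p + q))^-1 * sin ((p + q) * t).
have cf : continuous (fun t => sin (p * t) * sin (q * t)).
  by move=> x; apply: continuousM; exact: continuous_sinM.
have dF (x : R) : is_derive x 1 F (sin (p * x) * sin (q * x)).
  have h := (is_deriveB (is_deriveZ (2 * (p - q))^-1 (is_derive_sinM (p - q) x))
                       (is_deriveZ (2 * (p + q))^-1 (is_derive_sinM (p + q) x))).
  apply: (is_derive_eq h).
  rewrite /GRing.scale/= [(p - q) * x]mulrBl [(p + q) * x]mulrDl cosB cosD.
  by field; apply/andP.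
by rewrite (Rintegral_FTC d0 cf dF) /F sB sD !mulr0 sin0 !mulr0 subrr.
Qed.

Lemma Rintegral_sin_sqr p d : 0 < d -> p != 0 -> sin (2 * p * d) = 0 ->
  \int[mu]_(t in `[0, d]) (sin (p * t) * sin (p * t)) = d / 2.
Proof.
move=> d0 p0 s.
(* Antiderivative from [sin(pt)^2 = (1 - cos(2pt)) / 2]. *)
pose F (t : R) := 2^-1 * t - (4 * p)^-1 * sin ((2 * p) * t).
have cf : continuous (fun t => sin (p * t) * sin (p * t)).
  by move=> x; apply: continuousM; exact: continuous_sinM.
have dF (x : R) : is_derive x 1 F (sin (p * x) * sin (p * x)).
  have h := (is_deriveB (is_deriveZ 2^-1 (is_derive_id x (1 : R)))
                       (is_deriveZ (4 * p)^-1 (is_derive_sinM (2 * p) x))).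
  apply: (is_derive_eq h).
  rewrite /GRing.scale/= (_ : 2 * p * x = (p * x) *+ 2); last by ring.
  by rewrite cos_mulr2n -expr2 sin2cos2; field.
by rewrite (Rintegral_FTC d0 cf dF) /F s !mulr0 sin0 !mulr0; ring.
Qed.

(** The shift [n.+1] excludes the frequency 0, whose sine is the zero function. *)
Definition sinw d n : R -> R :=
  (fun t => sin (n.+1%:R * (pi / d) * t)) \_ `[0, d].

Lemma Rintegral_sinw_mul d m n : 0 < d ->
  \int[mu]_t (sinw d m t * sinw d n t) = if m == n then d / 2 else 0.
Proof.
move=> d0.
have -> : (fun t => sinw d m t * sinw d n t) = (fun t => sin (m.+1%:R * (pi / d) * t) *
    sin (n.+1%:R * (pi / d) * t)) \_ `[0, d].
  by apply/funext => t; rewrite /sinw !patchE; case: ifP; rewrite ?mulr0.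
have dn0 : d != 0 by rewrite gt_eqF.
have pi0 : (pi : R) != 0 by rewrite gt_eqF ?pi_gt0.
have pid0 : pi / d != 0 by rewrite mulf_neq0 ?invr_eq0.
rewrite -Rintegral_mkcond; case: eqVneq => [<-|mn].
  apply: Rintegral_sin_sqr => //; first by rewrite mulf_neq0 ?pnatr_eq0.
  rewrite (_ : _ * d = (2 * m.+1)%:R * pi) ?sin_natpi//.
  by rewrite natrM; field.
(* By symmetry; the difference of the frequencies is then a multiple of [pi / d] by the natural
   number [m - n]. *)
wlog mn' : m n mn / (n < m)%N.
  move=> H; case: (ltngtP m n) => [h|h|h]; [|exact: H|by rewrite h eqxx in mn].
  by rewrite -[RHS](H n m)// 1?eq_sym//; apply: eq_Rintegral => t _; rewrite mulrC.
apply: Rintegral_sin_mul => //.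
- by rewrite (inj_eq (mulIf pid0)) eqr_nat eqSS.
- by rewrite -mulrDl -natrD mulf_neq0// pnatr_eq0.
- rewrite (_ : _ * d = (m - n)%:R * pi) ?sin_natpi//.
  by rewrite -mulrBl -natrB ?subSS; [field|lia].
- rewrite (_ : _ * d = (m.+1 + n.+1)%:R * pi) ?sin_natpi//.
  by rewrite -mulrDl -natrD; field.
Qed.

Lemma normr_sinw_le d n t : `|sinw d n t| <= \1_`[0, d] t.
Proof.
rewrite /sinw patchE indicE; case: ifP => _; rewrite ?normr0//.
by rewrite ler_norml sin_geN1 sin_le1.
Qed.

Lemma measurable_sinw d n : measurable_fun setT (sinw d n).
Proof.
have m : measurable_fun `[0, d] (fun t => sin (n.+1%:R * (pi / d) * t)).
  apply: measurable_funTS; apply: continuous_measurable_fun.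
  exact: continuous_sinM.
exact: (measurable_restrictT _ _).1 m.
Qed.

Lemma sinw_Lfun2 d n : sinw d n \in Lfun mu 2%:E.
Proof.
apply/LfunE; split; first exact: measurable_sinw.
apply: (@le_finite_norm _ _ _ mu 2 _ (\1_`[0, d])) => //.
- exact: measurable_sinw.
- by move=> t; rewrite [leRHS]ger0_norm ?normr_sinw_le.
rewrite /finite_norm unlock; apply: poweR_lty.
rewrite (_ : (fun _ => _) = (fun t => (\1_`[0, d] t)%:E)).
  by rewrite integral_indic//= setIT lebesgue_measure_itv/=; case: ifP; rewrite ?ltry.
apply/funext => t; rewrite /= indicE normr_nat.
by case: (_ \in _); rewrite ?powR1// powR0// pnatr_eq0.
Qed.

Lemma sinw_CLfun2 d n : (fun t => (sinw d n t)%:C%C) \in CLfun mu 2%:E.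
Proof.
apply/CLfunP; first by rewrite ler1n.
split; first exact: sinw_Lfun2.
by have [] := Lfun_submod_closed mu (_ : (1 <= 2%:E :> \bar R)%E) => //;
  rewrite lee_fin ler1n.
Qed.

Definition sinC d n : CL2 mu := MkCL2 (sinw_CLfun2 d n).

Lemma CL2dot_sinC d m n : 0 < d ->
  CL2dot (sinC d m) (sinC d n) = (if m == n then d / 2 else 0)%:C%C.
Proof.
move=> d0; rewrite /CL2dot -Rintegral_sinw_mul//; congr (_ +i* _)%C.
  by apply: eq_Rintegral => t _ /=; ring.
by rewrite (@eq_Rintegral _ _ _ _ _ (cst 0)) ?Rintegral_cst ?mul0r// => t _ /=; ring.
Qed.

End sine_system.

(** * Integrals over translated windows *)

Section translated_windows.
Context {R : realType}.
Local Notation mu := (@lebesgue_measure R).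

Lemma ge0_integral_itv_translate (d l : R) (f : R -> \bar R) :
  measurable_fun setT f -> (forall x, 0 <= f x)%E ->
  (\int[mu]_(x in `[0%R, d]) f (x - l)%R = \int[mu]_(x in `[(- l)%R, (d - l)%R]) f x)%E.
Proof.
move=> mf f0; rewrite [LHS]integral_mkcond [RHS]integral_mkcond.
rewrite -[RHS](ge0_integral_translate l).
- apply: eq_integral => x _; rewrite !patchE.
  rewrite !mem_setE !in_itv/= lerD2r.
  by have -> : (- l <= x - l) = (0 <= x) by apply/idP/idP; lra.
- by apply: (measurable_restrictT _ _).1 => //; exact: measurable_funTS.
- by move=> x; rewrite patchE; case: ifP.
Qed.

(** After translation the windows [[- l i, d - l i]] are pairwise disjoint: a common point of two of
    them would force [|l i - l j| <= d]. *)
Lemma sum_integral_itv_translate_le (I : eqType) (l : I -> R) (s : seq I) (d : R)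
    (f : R -> \bar R) :
  measurable_fun setT f -> (forall x, 0 <= f x)%E -> uniq s ->
  {in s &, forall i j, i != j -> d < `|l i - l j|} ->
  (\sum_(i <- s) \int[mu]_(x in `[0%R, d]) f (x - l i)%R <= \int[mu]_x f x)%E.
Proof.
move=> mf f0 us sep.
under eq_bigr do rewrite ge0_integral_itv_translate//.
rewrite -ge0_integral_bigsetU//=.
- apply: ge0_subset_integral => //.
  by apply: bigsetU_measurable.
- move=> i j si sj [x [/=]]; rewrite !in_itv/= => /andP[i0 i1] /andP[j0 j1].
  apply/eqP; apply: contraT => ij.
  have := sep i j si sj ij; rewrite ltNge ler_norml.
  by case/negP; apply/andP; split; lra.
- exact: measurable_funTS.
Qed.

(** The windowed sine is dominated by the indicator of [[0, d]]; the factor 2 comes from bounding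
    real and imaginary parts separately. *)
Lemma normc_dot_sinC_le (d : R) (n : nat) (u : CL2 mu) :
  ((normc (CL2dot (sinC d n) u))%:E <=
    2%:E * \int[mu]_(x in `[0%R, d]) (normc (u x))%:E)%E.
Proof.
have /CLfunE[mr mi _] := CL2P u; have mn := measurable_normc mr mi.
have bnd (p : R[i] -> R) : (forall z, `|p z| <= normc z) ->
    mu.-integrable setT (EFin \o (fun x => p (sinC d n x * (u x)^*)%C)) ->
    (`|\int[mu]_x p (sinC d n x * (u x)^*)%C|%:E <=
      \int[mu]_(x in `[0%R, d]) (normc (u x))%:E)%E.
  move=> pz ip; rewrite EFin_normr_Rintegral// [leRHS]integral_mkcond.
  apply: le_trans (le_abse_integral _ _ _) _ => //.
    by have /integrableP[] := ip.
  apply: ge0_le_integral => //.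
  - by apply: measurableT_comp => //; have /integrableP[] := ip.
  - apply: (measurable_restrictT _ _).1 => //; apply: measurable_funTS.
    exact/measurable_EFinP.
  move=> x _; rewrite patchE.
  have hx : `|p (sinC d n x * (u x)^*)%C| <= \1_`[0, d] x * normc (u x).
    apply: le_trans (pz _) _; rewrite ComplexField.Normc.normcM.
    rewrite -[normc (u x)]normc_conj ler_wpM2r ?normc_ge0//.
    by rewrite Defs.normcE /= expr0n addr0 sqrtr_sqr normr_sinw_le.
  by move: hx; rewrite indicE; case: ifP => _; rewrite ?mul1r ?mul0r.
apply: le_trans (_ : (`|ReR (CL2dot (sinC d n) u)|%:E +
  `|ImR (CL2dot (sinC d n) u)|%:E <= _)%E).
  by rewrite -EFinD lee_fin normc_le.
rewrite (_ : 2%:E = 1 + 1)%E ?ge0_muleDl// ?mul1e.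
by apply: leeD; apply: bnd;
  [exact: Re_le_normc|exact: CL2_Re_mul|exact: Im_le_normc|exact: CL2_Im_mul].
Qed.

Lemma uniformly_discrete_sep (L : set R) : uniformly_discrete L ->
  exists2 d : R, 0 < d & forall x y, L x -> L y -> x != y -> d < `|x - y|.
Proof.
rewrite /uniformly_discrete; set S := [set _ | _ in _] => iS.
have lb x y : L x -> L y -> x != y -> (ereal_inf S <= `|x - y|%:E)%E.
  by move=> Lx Ly xy; apply: ereal_inf_lbound; exists (x, y) => //; split=> //; apply/eqP.
case: (ereal_inf S) iS lb => [r||]//.
  (* Half the infimum makes the separation strict. In the infinite case below, [L] has no two
     distinct points, so any positive [d] serves. *)
  rewrite lte_fin => r0 lb; exists (r / 2); first by lra.
  by move=> x y Lx Ly /(lb _ _ Lx Ly); rewrite lee_fin; lra.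
by move=> _ lb; exists 1 => // x y Lx Ly /(lb _ _ Lx Ly).
Qed.

End translated_windows.

(** * Translates of an integrable function *)

Theorem proposition2 (R : realType) (L : set R)
    (g : CL2 (@lebesgue_measure R)) :
  uniformly_discrete L ->
  QF_system (@CL2dot _ _ R lebesgue_measure)
    (fun l : L => translate (val l) g) ->
  (g : R -> R[i]) \notin CLfun (@lebesgue_measure R) 1%E.
Proof.
move=> /uniformly_discrete_sep[d d0 sep] [QF _].
apply/negP => /CLfunE[mr mi]; rewrite /finite_norm Lnorm1 => gfin.
have mg : measurable_fun setT (fun x => (normc (g x))%:E).
  by apply/measurable_EFinP; exact: measurable_normc.
have {}gfin : (\int[lebesgue_measure]_x (normc (g x))%:E < +oo)%E.
  apply: le_lt_trans gfin; rewrite le_eqVlt; apply/orP; left; apply/eqP.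
  by apply: eq_integral => x _ /=; rewrite ger0_norm ?normc_ge0.
(* Up to a factor 2, [B l] dominates the inner products with the translate by [l] for every [n]. *)
pose B (l : L) := (\int[lebesgue_measure]_(x in `[0%R, d]) (normc (g (x - val l)))%:E)%E.
have B0 l : (0 <= B l)%E by apply: integral_ge0 => x _; rewrite lee_fin normc_ge0.
have sumB (F : {fset L}) :
    (\sum_(l <- F) B l <= \int[lebesgue_measure]_x (normc (g x))%:E)%E.
  apply: (sum_integral_itv_translate_le (l := val)
    (f := fun x => (normc (g x))%:E)) => //.
  - by move=> x; rewrite lee_fin normc_ge0.
  - exact: fset_uniq.
  move=> i j _ _ ij; apply: sep; [exact: set_valP|exact: set_valP|].
  by rewrite (inj_eq val_inj).
have Bfin l : B l \is a fin_num.
  (* The sum bound on a singleton gives finiteness, so [fine (B l)] is the true value. *)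
  have := le_lt_trans (sumB [fset l]%fset) gfin.
  by rewrite big_seq_fset1 ge0_fin_numE.
have d2 : 0 < d / 2 by rewrite divr_gt0.
apply: (not_QF_approximation _ d2 (fun m n => CL2dot_sinC m n d0)
  (b := fun l => 2 * fine (B l))
  (M := 2 * fine (\int[lebesgue_measure]_x (normc (g x))%:E)%E) _ _ QF).
- move=> f /=; apply: Rintegral_ge0 => x _.
  by rewrite Re_mul_conj sqr_ge0.
- move=> n l; rewrite -lee_fin EFinM fineK//.
  exact: normc_dot_sinC_le.
- move=> F; rewrite -mulr_sumr ler_pM2l// -lee_fin fineK.
    rewrite -sumEFin; under eq_bigr do rewrite fineK//.
    exact: sumB.
  by rewrite ge0_fin_numE// integral_ge0// => x _; rewrite lee_fin normc_ge0.
Qed.
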